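(* Let $f$ be a generalized potential in $d$-dimensional space with $n \geq 2$ centers that satisfies the boundary conditions with signs $s_0, s_1, \dots, s_n \in \{-1,+1\}$ (and with some parameter $\delta > 0$). Then $f$ admits an equilibrium point $x$, i.e., a point $x$ of its domain with $\nabla f(x) = 0$, in each of the following cases: - the dimension $d$ is even; - the dimension $d$ is odd and $s_0 - \sum_{i=1}^n s_i \neq 0$.
   Context: For $\rho > 0$ and $x \in \mathbb{R}^d$ let $B_\rho(x) = \{y \in \mathbb{R}^d : \|x-y\|_2 \leq \rho\}$ and $\partial B_\rho(x) = \{y \in \mathbb{R}^d : \|x-y\|_2 = \rho\}$. A generalized potential in $d$-dimensional space with $n$ centers $a_1,\dots,a_n$ is a continuously differentiable function $f$ from the domain obtained from $B_R(0)$ by removing the interiors of the balls $B_r(a_i)$, $i=1,\dots,n$, to $\mathbb{R}$ (continuously differentiable up to the boundary of the domain), where the points $a_1,\dots,a_n \in \mathbb{R}^d$ are distinct, $r > 0$ satisfies $B_r(a_i) \cap B_r(a_j) = \emptyset$ for all distinct $i,j$, and $R > 0$ satisfies $\bigcup_i B_{2r}(a_i) \subset B_R(0)$. For $\delta>0$, $f$ satisfies the boundary conditions with signs $s_0,s_1,\dots,s_n\in\{-1,+1\}$ and parameter $\delta$ if: for all $x \in \partial B_R(0)$, $s_0 \cdot \langle \nabla f(x), x\rangle \geq \delta$; and for all $i \in \{1,\dots,n\}$ and all $x \in \partial B_r(a_i)$, $s_i \cdot \langle \nabla f(x), x - a_i\rangle \geq \delta$. *)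

(* Defs.v *)
From mathcomp Require Import all_boot all_order all_algebra.
From mathcomp Require Import all_classical all_reals all_analysis.

Set Implicit Arguments.
Unset Strict Implicit.
Unset Printing Implicit Defensive.

Import Order.TTheory GRing.Theory Num.Theory.
Import numFieldNormedType.Exports.

Local Open Scope classical_set_scope.
Local Open Scope ring_scope.

(* The library norm on 'rV[R]_d is the sup norm; it induces the usual topology
   and notion of differentiability, but balls and spheres below are Euclidean
   and therefore need their own norm. *)
Definition dot (R : realType) (d : nat) (u v : 'rV[R]_d) : R :=
  \sum_i u 0 i * v 0 i.

Definition norm2 (R : realType) (d : nat) (u : 'rV[R]_d) : R :=
  Num.sqrt (dot u u).

Definition Ball (R : realType) (d : nat) (rho : R) (x : 'rV[R]_d) :
    set 'rV[R]_d :=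
  [set y | norm2 (x - y) <= rho].

Definition Sphere (R : realType) (d : nat) (rho : R) (x : 'rV[R]_d) :
    set 'rV[R]_d :=
  [set y | norm2 (x - y) = rho].

Definition grad (R : realType) (d : nat) (f : 'rV[R]_d -> R) (x : 'rV[R]_d) :
    'rV[R]_d :=
  \row_i 'D_(delta_mx 0 i) f x.

(* Continuous differentiability up to the boundary: f is continuous on D and
   differentiable in the interior, and its gradient extends continuously to D.
   Only the values of f on D matter. *)
Definition C1_on (R : realType) (d : nat) (D : set 'rV[R]_d)
    (f : 'rV[R]_d -> R) : Prop :=
  [/\ {within D, continuous f},
      forall x, interior D x -> differentiable f x &
      exists g : 'rV[R]_d -> 'rV[R]_d,
        {within D, continuous g} /\ forall x, interior D x -> g x = grad f x].

(* Gradient at a point of D, possibly on its boundary, where it is the limit of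
   the gradients at interior points. By grad_onE, if f is C1_on D and D is in
   the closure of its interior (as the domains below are), this is the value of
   the continuous extension, hence the usual gradient at interior points. *)
Definition grad_on (R : realType) (d : nat) (D : set 'rV[R]_d)
    (f : 'rV[R]_d -> R) (x : 'rV[R]_d) : 'rV[R]_d :=
  lim (grad f y @[y --> within (interior D) (nbhs x)]).

Lemma grad_onE (R : realType) (d : nat) (D : set 'rV[R]_d)
    (f : 'rV[R]_d -> R) (g : 'rV[R]_d -> 'rV[R]_d) (x : 'rV[R]_d) :
  {within D, continuous g} -> (forall y, interior D y -> g y = grad f y) ->
  D x -> closure (interior D) x -> grad_on D f x = g x.
Proof.
move=> cg gE Dx clx.
have PF : ProperFilter (within (interior D) (nbhs x)).
  exact: within_nbhs_proper.
apply: cvg_lim; first exact: norm_hausdorff.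
move=> B nB.
have /subspace_continuousP/(_ x Dx)/(_ _ nB) := cg.
rewrite /= /nbhs /= /within /= => H; apply: filterS H => y By iDy.
by rewrite -gE//; apply: By; exact: interior_subset iDy.
Qed.

Definition pot_domain (R : realType) (d n : nat) (a : 'I_n -> 'rV[R]_d)
    (r rho : R) : set 'rV[R]_d :=
  Ball rho 0 `\` \bigcup_i interior (Ball r (a i)).

(* f is a generalized potential with centers a, small radius r and large
   radius rho. *)
Definition generalized_potential (R : realType) (d n : nat)
    (a : 'I_n -> 'rV[R]_d) (r rho : R) (f : 'rV[R]_d -> R) : Prop :=
  [/\ injective a,
      0 < r /\ (forall i j, i != j -> Ball r (a i) `&` Ball r (a j) = set0),
      0 < rho /\ \bigcup_i Ball (2 * r) (a i) `<=` Ball rho 0 &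
      C1_on (pot_domain a r rho) f].

Definition is_sign (s : int) : Prop := s = 1 \/ s = -1.

Definition boundary_conditions (R : realType) (d n : nat)
    (a : 'I_n -> 'rV[R]_d) (r rho : R) (f : 'rV[R]_d -> R)
    (s0 : int) (s : 'I_n -> int) (delta : R) : Prop :=
  let nabla := grad_on (pot_domain a r rho) f in
  (forall x, Sphere rho 0 x -> delta <= s0%:~R * dot (nabla x) x) /\
  (forall i x, Sphere r (a i) x ->
     delta <= (s i)%:~R * dot (nabla x) (x - a i)).

Definition equilibrium (R : realType) (d n : nat)
    (a : 'I_n -> 'rV[R]_d) (r rho : R) (f : 'rV[R]_d -> R)
    (x : 'rV[R]_d) : Prop :=
  pot_domain a r rho x /\ grad_on (pot_domain a r rho) f x = 0.

(* Main.v *)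
Require Import Defs.
From mathcomp Require Import all_boot all_order all_algebra.
From mathcomp Require Import all_classical all_reals all_analysis.
From mathcomp Require Import ring lra.

(** Suppose the gradient [g] has no zero. Label every point of a fine grid by the
    signs of the coordinates of the field equal to [g] on the domain, to
    [s_i (x - a_i)] in the removed balls and to [s_0 x] outside. A discrete
    mapping degree is the sum over the grid of [dg_1 dg_2 ... dg_d], where [dg_k]
    is the lattice differential of the k-th label in the (noncommutative)
    difference calculus. As this product is exact, the sum depends only on the
    labels near the boundary of the grid, so it is the same for the field
    [s_0 x]. A grid cube contributes only if every label changes on it, hence
    only if it contains some [a_i], and then it contributes [s_i ^ d].
    Therefore [s_0 ^ d = \sum_i s_i ^ d], which fails in both cases. *)

Set Implicit Arguments.
Unset Strict Implicit.
Unset Printing Implicit Defensive.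

Import Order.TTheory GRing.Theory Num.Theory.
Import numFieldNormedType.Exports.

Local Open Scope ring_scope.

(** * Difference forms on a lattice *)

Section LatticeForms.
Variables (d : nat) (T : finZmodType) (e : 'I_d -> T).
Implicit Types (w : T -> {set 'I_d} -> int) (g : T -> int) (A B : {set 'I_d}).

(* [w z A] is the coefficient at [z] of the wedge of the [dx_i], [i \in A], in
   increasing order. Multiplication by [dx_i] from the left shifts by [e i]. *)
Definition form_sign (i : 'I_d) A : int := (-1) ^+ #|[set j in A | (j < i)%N]|.

(** The lattice exterior derivative: [dx_i] is multiplied in from the left, and [form_sign] sorts it
    into its place in the increasing order. *)
Definition ext w (z : T) A : int :=
  \sum_(i in A) form_sign i A * (w (z + e i) (A :\ i) - w z (A :\ i)).

Definition scale g w (z : T) A : int := g z * w z A.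

(** The nesting [d(g_1 d(g_2 ...))] is exact by construction; by the Leibniz rule it equals the
    product [dg_1 dg_2 ...]. The empty product is the constant 0-form 1. *)
Definition ext_prod (gs : seq (T -> int)) : T -> {set 'I_d} -> int :=
  foldr (fun g w => ext (scale g w)) (fun=> fun A => (A == finset.set0)%:R) gs.

(** For [i < j], removing [j] leaves the number of elements below [i] unchanged, while removing [i]
    lowers the number below [j] by one. *)
Lemma form_sign_anti (i j : 'I_d) A : i \in A -> j \in A -> i != j ->
  form_sign i A * form_sign j (A :\ i) = - (form_sign j A * form_sign i (A :\ j)).
Proof.
wlog ij : i j / (i < j)%N.
  move=> H iA jA nij; case: (ltngtP i j) => ij.
  - exact: H.
  - by rewrite (H j i) ?opprK // eq_sym.
  - by move/ord_inj: ij nij => ->; rewrite eqxx.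
move=> iA jA nij; rewrite /form_sign.
have -> : [set k in A :\ j | (k < i)%N] = [set k in A | (k < i)%N].
  apply/setP=> k; rewrite !inE; case: eqP => //= ->.
  by rewrite (ltnNge j i) (ltnW ij) /= andbF.
have -> : #|[set k in A | (k < j)%N]| = #|[set k in A :\ i | (k < j)%N]|.+1.
  rewrite (cardsD1 i) !inE iA ij /= add1n; congr _.+1; apply: eq_card => k.
  by rewrite !inE; case: eqP.
by rewrite exprS mulN1r mulNr opprK mulrC.
Qed.

(** Second differences are symmetric in [i] and [j] while the signs are antisymmetric, so the double
    sum equals its own negative. *)
Lemma ext_ext w z A : ext (ext w) z A = 0.
Proof.
pose F i j := form_sign i A * form_sign j (A :\ i) *
  (w (z + e i + e j) (A :\ i :\ j) - w (z + e i) (A :\ i :\ j)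
   - (w (z + e j) (A :\ i :\ j) - w z (A :\ i :\ j))).
have E : ext (ext w) z A = \sum_(i in A) \sum_(j in A :\ i) F i j.
  apply: eq_bigr => i iA; rewrite /ext -sumrB big_distrr /=.
  by apply: eq_bigr => j jA; rewrite /F -mulrBr mulrA.
have E2 : \sum_(i in A) \sum_(j in A :\ i) F i j =
          - \sum_(i in A) \sum_(j in A :\ i) F i j.
  rewrite [RHS](_ : _ = - \sum_(j in A) \sum_(i in A :\ j) F i j); last first.
    congr (- _); rewrite (exchange_big_dep (mem A)) /=; last first.
      by move=> i j _; rewrite !inE => /andP[].
    apply: eq_bigr => j jA; apply: eq_bigl => i.
    by rewrite !inE jA andbT andbC eq_sym.
  rewrite -sumrN; apply: eq_bigr => i iA; rewrite -sumrN.
  apply: eq_bigr => j; rewrite !inE => /andP[ji jA].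
  rewrite /F form_sign_anti // 1?eq_sym // mulNr; congr (- (_ * _)).
  have -> : A :\ i :\ j = A :\ j :\ i.
    by apply/setP => k; rewrite !inE andbCA.
  rewrite -!addrA [e j + e i]addrC; congr (_ + _).
  by rewrite !opprD !opprK addrCA.
have /eqP : (\sum_(i in A) \sum_(j in A :\ i) F i j) *+ 2 = 0.
  by rewrite mulr2n {1}E2 addNr.
by rewrite E mulrn_eq0 => /eqP.
Qed.

Lemma ext_prod_closed gs z A : ext (ext_prod gs) z A = 0.
Proof.
case: gs => [|g gs]; last exact: ext_ext.
by rewrite /ext big1 // => i _; rewrite subrr mulr0.
Qed.

(** The Leibniz rule [d(g w) = dg w + g dw] with [dw = 0]. The factor [w] is evaluated at [z + e i]
    because [dx_i] stands to its left. *)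
Lemma ext_prod_cons g gs z A : ext_prod (g :: gs) z A =
  \sum_(i in A) form_sign i A * (g (z + e i) - g z) *
     ext_prod gs (z + e i) (A :\ i).
Proof.
have := ext_prod_closed gs z A; set w := ext_prod gs => w0.
have -> : ext_prod (g :: gs) z A = ext (scale g w) z A - g z * ext w z A.
  by rewrite w0 mulr0 subr0.
rewrite /ext big_distrr /= -sumrB.
apply: eq_bigr => i _; rewrite /scale [g z * (_ * _)]mulrCA -mulrBr -mulrA; congr (_ * _).
by rewrite mulrBr mulrBl opprB addrA subrK.
Qed.

(** Translation by [e i] permutes the finite group, so each difference sums to zero. *)
Lemma sum_ext w A : \sum_z ext w z A = 0.
Proof.
rewrite exchange_big big1 //= => i _; rewrite -big_distrr /= sumrB.
rewrite [X in X - _](reindex_inj (addIr (- e i))) /=.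
under eq_bigr do rewrite subrK.
by rewrite subrr mulr0.
Qed.

Definition corner (z : T) B := z + \sum_(i in B) e i.

Lemma corner0 z : corner z finset.set0 = z.
Proof. by rewrite /corner big_set0 addr0. Qed.

Lemma cornerU1 z B i : i \notin B -> corner z B + e i = corner z (i |: B).
Proof. by move=> iB; rewrite /corner big_setU1 //= -addrA [_ + e i]addrC. Qed.

(** The directions still to be used ([A]) stay disjoint from those already taken ([B]), so the
    recursion visits only the corners of one cube. *)
Lemma ext_prod_consC g gs z A B : [disjoint A & B] ->
  ext_prod (g :: gs) (corner z B) A =
  \sum_(i in A) form_sign i A * (g (corner z (i |: B)) - g (corner z B)) *
     ext_prod gs (corner z (i |: B)) (A :\ i).
Proof.
move=> AB; rewrite ext_prod_cons; apply: eq_bigr => i iA.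
by rewrite cornerU1 // (disjointFr AB).
Qed.

Lemma disjointD1U1 A B i : [disjoint A & B] -> [disjoint A :\ i & i |: B].
Proof.
move=> /pred0P AB; apply/pred0P => j /=; have := AB j; rewrite /= !inE.
by case: eqP => //=; case: (j \in A).
Qed.

Lemma eq_ext_prod (gs hs : seq (T -> int)) z A B : [disjoint A & B] ->
  size gs = size hs ->
  (forall k C, nth (fun=> 0) gs k (corner z C) = nth (fun=> 0) hs k (corner z C)) ->
  ext_prod gs (corner z B) A = ext_prod hs (corner z B) A.
Proof.
elim: gs hs A B => [|g gs IH] [|h hs] // A B AB [sE] gh.
rewrite !ext_prod_consC //; apply: eq_bigr => i iA.
have gh0 C : g (corner z C) = h (corner z C) := gh 0%N C.
rewrite !gh0 (IH hs) //; first exact: disjointD1U1.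
by move=> k; exact: (gh k.+1).
Qed.

Lemma ext_prod_const (gs : seq (T -> int)) z A B k c : [disjoint A & B] ->
  (k < size gs)%N -> (forall C, nth (fun=> 0) gs k (corner z C) = c) ->
  ext_prod gs (corner z B) A = 0.
Proof.
elim: gs A B k => [|g gs IH] // A B [|k] AB kgs gk;
  rewrite ext_prod_consC // big1 // => i iA.
  have g0 C : g (corner z C) = c := gk C.
  by rewrite !g0 subrr mulr0 mul0r.
by rewrite (IH _ _ k) ?mulr0 //; exact: disjointD1U1.
Qed.

(** The k-th label reacts only to the k-th direction, so [dg_k = (v_k - u_k) dx_k] on this cube and
    the product is a multiple of the volume form. *)
Lemma ext_prod_step (gs : seq (T -> int)) z (u v : 'I_d -> int) :
  size gs = d ->
  (forall (k : 'I_d) C,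
    nth (fun=> 0) gs k (corner z C) = if k \in C then v k else u k) ->
  ext_prod gs z [set: 'I_d]%SET = \prod_k (v k - u k).
Proof.
move=> sz gE.
(* The last [m] factors give only the coefficient of the last [m] directions. *)
have key m : (m <= d)%N -> forall A B, [disjoint A & B] ->
    ext_prod (drop (d - m) gs) (corner z B) A =
    (A == [set k : 'I_d | (d - m <= k)%N])%:R *
      \prod_(k < d | (d - m <= k)%N) (v k - u k).
  elim: m => [|m IH] md A B AB.
    have -> : drop (d - 0) gs = [::] by rewrite subn0 -sz drop_size.
    rewrite subn0 /= big1 ?mulr1 => [|k]; last first.
      by rewrite leqNgt ltn_ord.
    by congr (_ == _)%:R; apply/setP=> k; rewrite !inE leqNgt ltn_ord.
  have dm : (d - m.+1 < d)%N by rewrite -subSn // subSS leq_subr.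
  pose k := Ordinal dm.
  have kS : (d - m = (d - m.+1).+1)%N by rewrite subnSK.
  rewrite (drop_nth (fun=> 0)) ?sz // ext_prod_consC //.
  have gk C := gE k C; rewrite /= in gk.
  rewrite [X in _ = _ * X](_ : _ =
      (v k - u k) * \prod_(l < d | (d - m <= l)%N) (v l - u l)); last first.
    rewrite (bigD1 k) //=; congr (_ * _); apply: eq_bigl => l; rewrite kS ltn_neqAle andbC.
    by congr (_ && _); rewrite -val_eqE eq_sym.
  (* Here [k] is the least element of [A], so [dx_k] already stands first. *)
  have sgE : A = [set l : 'I_d | (d - m.+1 <= l)%N] -> form_sign k A = 1.
    move=> ->; rewrite /form_sign (_ : finset _ = finset.set0) ?cards0 //.
    by apply/setP=> l; rewrite !inE /= leqNgt; case: ltnP.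
  have AkE : k \in A -> (A :\ k == [set l : 'I_d | (d - m <= l)%N]) =
                        (A == [set l : 'I_d | (d - m.+1 <= l)%N]).
    move=> kA.
    have -> : [set l : 'I_d | (d - m <= l)%N] =
              [set l : 'I_d | (d - m.+1 <= l)%N] :\ k.
      by apply/setP=> l; rewrite !inE kS ltn_neqAle -val_eqE /= eq_sym.
    apply/eqP/eqP => [E|-> //].
    rewrite -(finset.setD1K kA) E finset.setD1K // inE; exact: leqnn.
  case: (boolP (k \in A)) => kA; last first.
    rewrite big1 => [|i iA]; last first.
      rewrite !gk !inE; have /negPf -> : k != i by apply: contraNneq kA => ->.
      by rewrite /= subrr mulr0 mul0r.
    case: eqP => [AE|]; last by rewrite mul0r.
    by move: kA; rewrite AE inE leqnn.
  rewrite (bigD1 k) //= [X in _ + X]big1 ?addr0; last first.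
    move=> i /andP[iA ik]; rewrite !gk !inE eq_sym (negPf ik) /=.
    by rewrite subrr mulr0 mul0r.
  rewrite !gk !inE eqxx /= (disjointFr AB kA) -kS IH ?(ltnW md) //; last first.
    exact: disjointD1U1.
  rewrite AkE //; case: eqP => [/sgE ->|]; last by rewrite !mul0r mulr0.
  by rewrite !mul1r.
have := key d (leqnn d) [set: 'I_d]%SET finset.set0.
rewrite subnn drop0 corner0 => ->; last by rewrite fintype.disjoint_sym finset.disjoints_subset finset.sub0set.
rewrite (_ : _ == _); last by apply/eqP/setP => k; rewrite !inE.
by rewrite mul1r; apply: eq_bigl.
Qed.

End LatticeForms.

(** * Degree of a labelling of a grid *)

Section TorusGrid.
Variables (d M : nat).
Local Notation grid := 'rV['I_M.+2]_d.
Implicit Types (z : grid) (g h : 'I_d -> grid -> int).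

(** Addition in ['I_M.+2] is modulo [M + 2], so the grid is a discrete torus. *)
Definition unit_shift (i : 'I_d) : grid := delta_mx 0 i.

Definition local_degree g z : int :=
  ext_prod unit_shift [seq g k | k <- enum 'I_d] z [set: 'I_d]%SET.

(** The last index is [M + 1]; excluding it leaves the cubes that do not wrap around the torus. *)
Definition off_seam z := [forall k, (z 0%R k < M.+1)%N].

Lemma nth_labels g (k : 'I_d) :
  nth (fun=> 0) [seq g k | k <- enum 'I_d] k = g k.
Proof. by rewrite (nth_map k) ?size_enum_ord // nth_ord_enum. Qed.

Lemma size_labels g : size [seq g k | k <- enum 'I_d] = d.
Proof. by rewrite size_map size_enum_ord. Qed.

Lemma cornerE z (B : {set 'I_d}) k :
  corner unit_shift z B 0 k = z 0 k + (k \in B)%:R.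
Proof.
rewrite /corner mxE summxE; congr (_ + _); case: (boolP (k \in B)) => kB.
  rewrite (bigD1 k) //= mxE !eqxx /= big1 ?addr0 // => i /andP[_ ik].
  by rewrite mxE eq_sym (negPf ik).
rewrite big1 // => i iB; rewrite mxE eqxx /=.
by have /negPf -> : k != i by apply: contraNneq kB => ->.
Qed.

Lemma val_corner z (B : {set 'I_d}) k : off_seam z ->
  corner unit_shift z B 0 k = (z 0%R k + (k \in B))%N :> nat.
Proof.
move=> /forallP/(_ k) zk; rewrite cornerE; case: (k \in B) => /=.
  by rewrite [(1 %% _)%N]modn_small // addn1 modn_small.
by rewrite addn0 modn_small.
Qed.

Lemma local_degree_const g z k c :
  (forall B, g k (corner unit_shift z B) = c) -> local_degree g z = 0.
Proof.
move=> gc; rewrite /local_degree -[z](corner0 unit_shift).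
apply: (@ext_prod_const _ _ _ _ _ _ _ k c).
- by rewrite fintype.disjoint_sym finset.disjoints_subset finset.sub0set.
- by rewrite size_labels.
- by move=> B; rewrite nth_labels.
Qed.

Lemma local_degree_step g z (u v : 'I_d -> int) :
  (forall k B, g k (corner unit_shift z B) = if k \in B then v k else u k) ->
  local_degree g z = \prod_k (v k - u k).
Proof.
move=> gE; apply: ext_prod_step; first exact: size_labels.
by move=> k B; rewrite nth_labels.
Qed.

Lemma eq_local_degree g h z :
  (forall k B, g k (corner unit_shift z B) = h k (corner unit_shift z B)) ->
  local_degree g z = local_degree h z.
Proof.
move=> gh; rewrite /local_degree -[z](corner0 unit_shift).
apply: eq_ext_prod.
- by rewrite fintype.disjoint_sym finset.disjoints_subset finset.sub0set.
- by rewrite !size_labels.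
- move=> k B; case: (ltnP k d) => kd; last by rewrite !nth_default ?size_labels.
  by rewrite -[k]/(val (Ordinal kd)) !nth_labels.
Qed.

(** For [d > 0] the product has a leading factor and is exact; in dimension 0 it is the constant
    1. *)
Lemma sum_local_degree g : (0 < d)%N -> \sum_z local_degree g z = 0.
Proof.
move=> d0; rewrite /local_degree.
case: [seq _ | _ <- _] (size_labels g) => [d00|h gs _]; last exact: sum_ext.
by rewrite -d00 in d0.
Qed.

(* The total degree over the torus vanishes, so the degree off the seam only
   depends on the labels next to the seam. *)
Lemma eq_sum_local_degree g h : (0 < d)%N ->
  (forall z, [exists k, (z 0 k == 0%N :> nat) || (z 0 k == M.+1 :> nat)] ->
     forall k, g k z = h k z) ->
  \sum_(z | off_seam z) local_degree g z =
  \sum_(z | off_seam z) local_degree h z.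
Proof.
move=> d0 gh; have := etrans (sum_local_degree g d0) (esym (sum_local_degree h d0)).
rewrite (bigID off_seam) [in RHS](bigID off_seam) /=.
rewrite [X in _ + X = _](_ : _ = \sum_(z | ~~ off_seam z) local_degree h z).
  exact: addIr.
apply: eq_bigr => z; rewrite negb_forall => /existsP[k zk].
apply: eq_local_degree => l B; apply: gh; apply/existsP; exists k.
have {zk} zk : z 0 k = ord_max.
  by apply: val_inj; apply/eqP; rewrite eqn_leq -ltnS ltn_ord leqNgt.
(* The k-th coordinate of a corner is [M + 1] or, after wrapping, [0], so all corners of the cube
   lie where [g] and [h] agree. *)
rewrite cornerE zk; case: (k \in B); last by rewrite addr0 eqxx orbT.
by rewrite /= [(1 %% _)%N]modn_small // addn1 modnn.
Qed.

End TorusGrid.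

Local Open Scope classical_set_scope.

(** * Lebesgue numbers of compact sets *)

Section LebesgueNumber.
Variables (R : realType) (X : pseudoMetricType R).

Lemma compact_lebesgue_number (K : set X) (Q : set (set X)) : compact K ->
  (forall A B, A `<=` B -> Q B -> Q A) ->
  (forall x, K x -> exists2 V, nbhs x V & Q V) ->
  \forall e \near 0^'+, forall x, K x -> Q (ball x e).
Proof.
move=> /compact_near_coveringP cK Qanti Qloc.
apply: (cK R (0^'+) (fun e x => Q (ball x e))) => x /Qloc[V].
rewrite -nbhs_ballE => -[e /= e0 eV] QV.
(* Half of the radius is spent on moving the centre, half on the ball around it. *)
exists (ball x (e / 2), [set t | t < e / 2]) => /=.
  split; first by apply: nbhsx_ballx; rewrite divr_gt0.
  by apply: nbhs_right_lt; rewrite divr_gt0.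
move=> [y t] /= [xy te]; apply: Qanti QV => w yw; apply: eV.
by apply: ball_split xy _; apply: le_ball yw; exact: ltW.
Qed.

End LebesgueNumber.

(** * Degree of a labelling with finitely many singular points *)

Section DegreeCount.
Variables (R : realType) (d : nat) (L : R).
Hypothesis L0 : 0 < L.

(** The [M + 2] grid points on each axis run from [-L] to [L] in [M + 1] steps. *)
Definition mesh M : R := 2 * L / M.+1%:R.

Definition grid_pt M (z : 'rV['I_M.+2]_d) : 'rV[R]_d :=
  \row_k (- L + mesh M * (z 0 k)%:R).

Definition grid_label (G : 'rV[R]_d -> 'I_d -> bool) M (k : 'I_d)
  (z : 'rV['I_M.+2]_d) : int := (G (grid_pt z) k)%:R.

(** Cells are half-open, so that a centre on a grid line is counted once. *)
Definition in_cell M (a : 'rV[R]_d) (z : 'rV['I_M.+2]_d) :=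
  [forall k, grid_pt z 0 k <= a 0 k < grid_pt z 0 k + mesh M].

Lemma mesh_gt0 M : 0 < mesh M.
Proof. by rewrite divr_gt0 ?mulr_gt0. Qed.

Lemma mesh_small (e : R) : 0 < e -> \forall M \near \oo, mesh M < e.
Proof.
move=> e0; near=> M.
rewrite /mesh ltr_pdivrMr // [e * _]mulrC -ltr_pdivrMr //.
have p : 0 <= 2 * L / e by rewrite divr_ge0 ?mulr_ge0 ?ltW.
have /andP[_ /lt_le_trans] := truncn_itv p; apply.
by rewrite ler_nat ltnS; near: M; exact: nbhs_infty_ge.
Unshelve. all: by end_near. Qed.

Lemma grid_pt_corner M (z : 'rV['I_M.+2]_d) (B : {set 'I_d}) k : off_seam z ->
  grid_pt (corner (@unit_shift d M) z B) 0 k =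
  grid_pt z 0 k + (if k \in B then mesh M else 0).
Proof.
move=> zs; rewrite [LHS]mxE [in RHS]mxE val_corner // natrD mulrDr addrA; congr (_ + _).
by case: (k \in B); rewrite ?mulr1 ?mulr0.
Qed.

(** The k-th index of the only cell containing [a] is the integer part of [(a_k + L) / mesh]; it is
    at most [M] because [a_k < L]. *)
Lemma sum_in_cell M (a : 'rV[R]_d) : (forall k, - L <= a 0 k < L) ->
  \sum_(z : 'rV['I_M.+2]_d | off_seam z) (in_cell a z)%:R = 1 :> int.
Proof.
move=> aL; have m0 := mesh_gt0 M.
pose t k := Num.trunc ((a 0 k + L) / mesh M).
have pos k : 0 <= (a 0 k + L) / mesh M.
  by rewrite divr_ge0 ?(ltW m0) // -lerBlDr sub0r; case/andP: (aL k).
have tM k : (t k < M.+1)%N.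
  rewrite /t truncn_lt_nat // ltr_pdivrMr //.
  rewrite /mesh mulrCA divff ?pnatr_eq0 // mulr1 mulrDl mul1r ltrD2r.
  by case/andP: (aL k).
pose z0 : 'rV['I_M.+2]_d := \row_k inord (t k).
have z0E k : z0 0 k = t k :> nat by rewrite mxE inordK // ltnS ltnW.
have cellE z : in_cell a z = (z == z0).
  have E k : (grid_pt z 0 k <= a 0 k < grid_pt z 0 k + mesh M) = (z 0 k == t k :> nat).
    rewrite mxE -[X in _ < _ + X]mulr1 -addrA -mulrDr natr1.
    rewrite ![- L + _]addrC lerBlDr ltrBrDr.
    rewrite -ler_pdivlMl // -ltr_pdivrMl // ![(mesh M)^-1 * _]mulrC.
    rewrite -truncn_lt_nat // -truncn_ge_nat //.
    by rewrite -/(t k) ltnS eqn_leq.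
  apply/forallP/eqP => [H|zz0 k]; last by rewrite E zz0 z0E.
  by apply/rowP => k; apply: val_inj; rewrite /= z0E; apply/eqP; rewrite -E.
rewrite (bigD1 z0) /=; last by apply/forallP => k; rewrite z0E.
rewrite cellE eqxx big1 // => z /andP[_ /negPf zz0].
by rewrite cellE zz0.
Qed.

(** Once the mesh is below a Lebesgue number, each cube either lies in some [U i], where its degree
    is explicit, or has a constant label and degree 0. *)
Lemma sum_local_degree_labels (n : nat) (G : 'rV[R]_d -> 'I_d -> bool)
    (a : 'I_n -> 'rV[R]_d) (b : 'I_n -> bool) (U : 'I_n -> set 'rV[R]_d) :
  (forall i k, - L <= a i 0 k < L) ->
  (forall i, nbhs (a i) (U i)) ->
  (forall i j x, U i x -> U j x -> i = j) ->
  (forall i x, U i x -> forall k, G x k = (a i 0 k < x 0 k) (+) b i) ->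
  (forall x, (forall i, x != a i) ->
     exists k c, \forall y \near x, G y k = c) ->
  \forall M \near \oo, \sum_(z : 'rV['I_M.+2]_d | off_seam z)
     local_degree (grid_label G (M := M)) z = \sum_i ((-1) ^+ b i) ^+ d.
Proof.
move=> aL aU Udisj GU Gloc.
pose K : set 'rV[R]_d := [set v | forall k, `[- L, L] (v ord0 k)].
have cK : compact K by exact: (@rV_compact R d (fun=> `[- L, L]) (fun=> @segment_compact R _ _)).
(* The second alternative also excludes the centres, so that such a cube contributes 0 to the count
   of centres as well. *)
pose Q (V : set 'rV[R]_d) := (exists i, V `<=` U i) \/
  (exists k c, forall y, V y -> G y k = c /\ forall i, y != a i).
have : \forall e \near 0^'+, forall x, K x -> Q (ball x e).
  apply: compact_lebesgue_number => //.
    move=> A B AB [[i Bi]|[k [c Bk]]].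
      by left; exists i; exact: subset_trans Bi.
    by right; exists k, c => y /AB; exact: Bk.
  move=> x _; have [[i ->]|xa] := pselect (exists i, x = a i).
    by exists (U i) => //; left; exists i.
  have {}xa i : x != a i by apply/eqP => xi; apply: xa; exists i.
  have [k [c kc]] := Gloc _ xa.
  exists [set y | G y k = c /\ forall i, y != a i]; last first.
    by right; exists k, c => y [].
  apply: filterI => //.
  apply: (@filter_forall _ _ (fun i y => y != a i) (nbhs x) (nbhs_filter x)) => i.
  have oa : open (~` [set a i]).
    by apply: closed_openC; apply: compact_closed;
      [exact: norm_hausdorff | exact: compact_set1].
  have /(conj oa)/open_nbhs_nbhs : (~` [set a i]) x by exact/eqP.
  by apply: filterS => y /= /eqP.
move=> He.
have /filter_ex[e [e0 {}He]] :
    \forall e \near (0 : R)^'+, 0 < e /\ forall x, K x -> Q (ball x e).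
  by apply: filterI => //; exact: nbhs_right_gt.
near=> M; have me : mesh M < e by near: M; exact: mesh_small.
have m0 := mesh_gt0 M.
(* It suffices to compare cube by cube: centre [i] contributes only in the one cell that contains
   it. *)
transitivity (\sum_(z : 'rV['I_M.+2]_d | off_seam z)
    \sum_i (in_cell (a i) z)%:R * ((-1) ^+ b i) ^+ d : int); last first.
  rewrite exchange_big; apply: eq_bigr => i _.
  by rewrite -big_distrl /= sum_in_cell ?mul1r.
apply: eq_bigr => z zs.
have Kz : K (grid_pt z).
  move=> k /=; rewrite in_itv /= mxE lerDl mulr_ge0 ?(ltW m0) //=.
  rewrite -lerBrDl opprK /mesh mulrAC ler_pdivrMr // -mulr2n mulr_natl.
  by rewrite ler_wpM2l ?mulrn_wge0 ?(ltW L0) // ler_nat -ltnS ltn_ord.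
have cornb B : ball (grid_pt z) e (grid_pt (corner (@unit_shift d M) z B)).
  split=> // i k; rewrite ord1 /ball /= grid_pt_corner // opprD addNKr normrN.
  by case: (k \in B); rewrite ?normr0 // gtr0_norm.
have cellb (i : 'I_n) : in_cell (a i) z -> ball (grid_pt z) e (a i).
  move=> /forallP ci; split=> // j k; rewrite ord1 /ball /=.
  have /andP[c1 c2] := ci k; rewrite distrC ger0_norm ?subr_ge0 //.
  by apply: lt_trans me; rewrite ltrBlDl.
have [[i zU]|[k [c zc]]] := He _ Kz; last first.
  rewrite (@local_degree_const _ _ _ _ k (c%:R)); last first.
    by move=> B; rewrite /grid_label (zc _ (cornb B)).1.
  rewrite big1 // => i _; case: (boolP (in_cell _ _)) => [ci|]; last by rewrite mul0r.
  by have := (zc _ (cellb _ ci)).2 i; rewrite eqxx.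
(* The cube lies in [U i], and the sets [U j] are disjoint, so no other centre is in its cell. *)
rewrite (bigD1 i) //= [X in _ + X]big1 ?addr0; last first.
  move=> j ji; case: (boolP (in_cell _ _)) => [/cellb/zU|]; last by rewrite mul0r.
  by move=> Ui; case/eqP: ji; apply: Udisj Ui; exact: nbhs_singleton.
rewrite (@local_degree_step _ _ _ _
  (fun k => ((a i 0 k < grid_pt z 0 k) (+) b i)%:R)
  (fun k => ((a i 0 k < grid_pt z 0 k + mesh M) (+) b i)%:R)); last first.
  move=> k B; rewrite /grid_label (GU _ _ (zU _ (cornb B))) grid_pt_corner //.
  by case: ifP; rewrite ?addr0.
(* Along an edge the label jumps by [(-1) ^+ b i] if the centre's coordinate lies in the half-open
   edge, and by 0 otherwise; the product over [k] thus tests [in_cell]. *)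
have stepE (t u v : R) : u < v ->
    ((t < v)%R (+) b i)%:R - ((t < u)%R (+) b i)%:R =
    (u <= t < v)%R%:R * (-1) ^+ b i :> int.
  move=> uv; case: (ltP t u) => tu /=; last by case: (_ < _); case: (b i).
  by rewrite (lt_trans tu uv) subrr mul0r.
under eq_bigr do rewrite stepE ?ltrDl //.
rewrite big_split /= prodr_const card_ord; congr (_ * _).
case: (boolP (in_cell _ _)) => [/forallP ci|].
  by rewrite big1 // => k _; rewrite ci.
by rewrite negb_forall => /existsP[k /negPf nk]; rewrite (bigD1 k) //= nk mul0r.
Unshelve. all: by end_near. Qed.

End DegreeCount.

(** * Euclidean geometry of the domain *)

Section Euclidean.
Variables (R : realType) (d : nat).
Implicit Types (u v x y : 'rV[R]_d) (r : R).

Definition sqn u : R := dot u u.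

Lemma sqnZ (t : R) u : sqn (t *: u) = t ^+ 2 * sqn u.
Proof.
rewrite /sqn /dot big_distrr; apply: eq_bigr => i _.
by rewrite !mxE mulrACA expr2.
Qed.

Lemma sqn_ge0 u : 0 <= sqn u.
Proof. by apply: sumr_ge0 => i _; rewrite -expr2 sqr_ge0. Qed.

Lemma sqnN u : sqn (- u) = sqn u.
Proof. by apply: eq_bigr => i _; rewrite !mxE mulrNN. Qed.

Lemma coord_sqn u k : u 0 k ^+ 2 <= sqn u.
Proof.
rewrite /sqn /dot (bigD1 k) //= -expr2 lerDl.
by apply: sumr_ge0 => i _; rewrite -expr2 sqr_ge0.
Qed.

Lemma sqnD_le u v : sqn (u + v) <= 2 * (sqn u + sqn v).
Proof.
rewrite /sqn /dot -big_split big_distrr; apply: ler_sum => i _ /=.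
rewrite !mxE; set p := u _ _; set q := v _ _.
rewrite -subr_ge0 (_ : _ - _ = (p - q) ^+ 2) ?sqr_ge0 //.
by ring.
Qed.

Lemma BallE r x y : 0 <= r -> Ball r x y = (sqn (y - x) <= r ^+ 2) :> Prop.
Proof.
move=> r0; rewrite /Ball /= /norm2 -/(sqn _) -sqnN opprB; congr is_true.
by rewrite -[in LHS](ger0_norm r0) -sqrtr_sqr ler_sqrt // sqr_ge0.
Qed.

Lemma SphereE r x y : 0 <= r -> sqn (y - x) = r ^+ 2 -> Sphere r x y.
Proof.
by move=> r0 E; rewrite /Sphere /= /norm2 -/(sqn _) -sqnN opprB E sqrtr_sqr ger0_norm.
Qed.

Lemma sqn_continuous x : continuous (fun y => sqn (y - x)).
Proof.
apply: continuous_big => [|i _ y]; first exact: add_continuous.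
have c : {for y, continuous (fun z : 'rV[R]_d => (z - x) 0 i)}.
  have -> : (fun z : 'rV[R]_d => (z - x) 0 i) = (fun z => z 0 i - x 0 i).
    by apply/funext => z; rewrite !mxE.
  apply: continuousB; last exact: cst_continuous.
  exact: coord_continuous.
exact: (continuousM c c).
Qed.

Lemma near_sqn_lt x y r : sqn (y - x) < r -> \forall z \near y, sqn (z - x) < r.
Proof. by move=> yr; exact: (cvgr_lt _ (@sqn_continuous x y) _ yr). Qed.

Lemma near_sqn_gt x y r : r < sqn (y - x) -> \forall z \near y, r < sqn (z - x).
Proof. by move=> yr; exact: (cvgr_gt _ (@sqn_continuous x y) _ yr). Qed.

Lemma near_ray (P : set 'rV[R]_d) x v : nbhs x P ->
  \forall t \near (0 : R)^'+, P (x + t *: v).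
Proof.
move=> xP; have c : x + t *: v @[t --> (0 : R)] --> x.
  rewrite -[X in _ --> X]addr0 -[in X in _ --> X](scale0r v).
  apply: cvgD; first exact: cvg_cst.
  by apply: cvgZr_tmp; exact: cvg_id.
exact: (cvg_at_right_filter c) xP.
Qed.

Lemma interior_BallE r x y : 0 < r ->
  interior (Ball r x) y <-> sqn (y - x) < r ^+ 2.
Proof.
move=> r0; have r0' := ltW r0; split=> [iy|lt]; last first.
  by apply: filterS (near_sqn_lt lt) => z zx; rewrite BallE // ltW.
have := nbhs_singleton iy; rewrite /= BallE // le_eqVlt => /orP[/eqP yx|//].
(* If [y] were on the sphere, a small radial push outward would have to stay in the ball. *)
have /filter_ex[t [t0]] : \forall t \near (0 : R)^'+,
    0 < t /\ Ball r x (y + t *: (y - x)).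
  by apply: filterI; [exact: nbhs_right_gt | exact: near_ray].
rewrite BallE // addrAC -[X in X + _ *: _]scale1r -scalerDl sqnZ yx.
rewrite ger_pMl ?exprn_gt0 // expr_le1 // ?addr_ge0 ?(ltW t0) //.
by rewrite gerDl leNgt t0.
Qed.

Lemma near_coord_gt (a x : 'rV[R]_d) k : x 0 k != a 0 k ->
  \forall y \near x, (a 0 k < (y : 'rV[R]_d) 0 k) = (a 0 k < x 0 k).
Proof.
have c := @coord_continuous R 1 d 0 k x.
case: ltgtP => // xa _; first exact: (cvgr_gt _ c _ xa).
apply: filterS (cvgr_lt _ c _ xa) => y ya.
by rewrite ltNge ltW.
Qed.

Lemma row_neq_coord (x y : 'rV[R]_d) : x != y -> exists k, x 0 k != y 0 k.
Proof.
move=> xy; apply/existsP; apply: contraT; rewrite negb_exists => /forallP H.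
by case/eqP: xy; apply/rowP => k; apply/eqP; have := H k; rewrite negbK.
Qed.

Lemma sign_prodP (b : bool) (p q : R) :
  0 < (-1) ^+ b * (p * q) -> (0 < p) = (0 < q) (+) b.
Proof.
case: b; rewrite ?expr1 ?expr0 ?mulN1r ?mul1r ?oppr_gt0.
  by case: (ltgtP 0 q) => [q0|q0|<-]; rewrite ?(pmulr_llt0 _ q0) ?(nmulr_llt0 _ q0)
    ?mulr0 ?ltxx //= => p0; rewrite ?p0 // ltNge ltW.
by case: (ltgtP 0 q) => [q0|q0|<-]; rewrite ?(pmulr_lgt0 _ q0) ?(nmulr_lgt0 _ q0)
    ?mulr0 ?ltxx //= => p0; rewrite ?p0 // ltNge ltW.
Qed.

(** A positive sum has a positive term. On a boundary sphere this yields a coordinate in which the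
    gradient and the signed radial field have the same strict sign. *)
Lemma dot_gt0_coord (b : bool) (u v : 'rV[R]_d) :
  0 < (-1) ^+ b * dot u v -> exists k,
  [/\ u 0 k != 0, v 0 k != 0 & (0 < u 0 k) = (0 < v 0 k) (+) b].
Proof.
move=> uv; have [/existsP[k kp]|] :=
    boolP [exists k, 0 < (-1) ^+ b * (u 0 k * v 0 k)].
  exists k; split; last exact: sign_prodP.
    by apply: contraTneq kp => ->; rewrite mul0r mulr0 ltxx.
  by apply: contraTneq kp => ->; rewrite !mulr0 ltxx.
rewrite negb_exists => /forallP H; move: uv; rewrite /dot big_distrr ltNge /=.
by rewrite sumr_le0 // => k _; rewrite leNgt.
Qed.

End Euclidean.

(** * The large ball with the small balls removed *)

Section Domain.
Variables (R : realType) (d n : nat) (a : 'I_n -> 'rV[R]_d) (r rho : R).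
Hypotheses (r0 : 0 < r) (rho0 : 0 < rho).
Hypothesis balls_disjoint :
  forall i j, i != j -> Ball r (a i) `&` Ball r (a j) = set0.
Hypothesis balls_inside : \bigcup_i Ball (2 * r) (a i) `<=` Ball rho 0.

Local Notation D := (pot_domain a r rho).

Lemma pot_domainE x :
  D x <-> sqn x <= rho ^+ 2 /\ forall i, r ^+ 2 <= sqn (x - a i).
Proof.
rewrite /pot_domain /= BallE ?(ltW rho0) // subr0; split=> -[xr H]; split=> //.
  move=> i; rewrite leNgt; apply/negP => lt; apply: H; exists i => //.
  exact/interior_BallE.
by move=> [i _ /interior_BallE-/(_ r0)]; rewrite ltNge H.
Qed.

Lemma interior_pot_domain x : sqn x < rho ^+ 2 ->
  (forall i, r ^+ 2 < sqn (x - a i)) -> interior D x.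
Proof.
move=> xr xa; have xr' : \forall y \near x, sqn y < rho ^+ 2.
  have := @near_sqn_lt R d 0 x (rho ^+ 2); rewrite subr0 => /(_ xr).
  by apply: filterS => y; rewrite subr0.
have xa' : \forall y \near x, forall i, r ^+ 2 < sqn (y - a i).
  by apply: (@filter_forall _ _ (fun i y => r ^+ 2 < sqn (y - a i)) (nbhs x)) => i; exact: near_sqn_gt.
apply: filterS (filterI xr' xa') => y [yr ya].
by apply/pot_domainE; split; [exact: ltW | move=> i; exact: ltW].
Qed.

Lemma other_balls_far i j x : i != j -> sqn (x - a i) <= r ^+ 2 ->
  r ^+ 2 < sqn (x - a j).
Proof.
move=> ij xi; rewrite ltNge; apply/negP => xj.
have : (Ball r (a i) `&` Ball r (a j)) x by split; rewrite BallE ?(ltW r0).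
by rewrite balls_disjoint.
Qed.

(** If [x] had norm [m >= rho], pushing it radially outward by [r] would give a point within [2 * r]
    of [a i] but of norm [m + r > rho]. *)
Lemma ball_inside i x : sqn (x - a i) <= r ^+ 2 -> sqn x < rho ^+ 2.
Proof.
move=> xi; rewrite ltNge; apply/negP => xr.
pose m := Num.sqrt (sqn x); have m2 : m ^+ 2 = sqn x by rewrite sqr_sqrtr ?sqn_ge0.
have m_rho : rho <= m by rewrite -(ler_pXn2r (_ : 0 < 2)%N) ?nnegrE ?sqrtr_ge0 ?(ltW rho0) // m2.
have m0 : 0 < m := lt_le_trans rho0 m_rho.
pose t := r / m; have t0 : 0 < t by rewrite divr_gt0.
have yE : sqn (x + t *: x) = (m + r) ^+ 2.
  rewrite -[X in X + _]scale1r -scalerDl sqnZ -m2 -exprMn; congr (_ ^+ _).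
  by rewrite mulrDl mul1r divfK // gt_eqF.
have : Ball rho 0 (x + t *: x).
  apply: balls_inside; exists i => //; rewrite BallE ?mulr_ge0 ?(ltW r0) //.
  rewrite addrAC; apply: le_trans (sqnD_le _ _) _.
  rewrite sqnZ -m2 -exprMn divfK ?gt_eqF // exprMn; lra.
rewrite BallE ?(ltW rho0) // subr0 yE ler_pXn2r ?nnegrE ?addr_ge0 ?(ltW r0) ?(ltW m0) ?(ltW rho0) //.
by rewrite leNgt (le_lt_trans m_rho) // ltrDl.
Qed.

Lemma center_inside i : sqn (a i) < rho ^+ 2.
Proof.
apply: (@ball_inside i); rewrite subrr /sqn /dot big1 ?sqr_ge0 // => k _.
by rewrite mxE mul0r.
Qed.

Lemma outer_point_far x i : rho ^+ 2 <= sqn x -> r ^+ 2 < sqn (x - a i).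
Proof. by move=> xr; rewrite ltNge; apply/negP => /ball_inside; rewrite ltNge xr. Qed.

(** A short move leads into the interior: towards the origin from the outer sphere, away from the
    centre from an inner sphere, and by the zero vector otherwise. This makes [grad_onE] available
    on the boundary. *)
Lemma closure_interior_pot_domain x : D x -> closure (interior D) x.
Proof.
move=> /pot_domainE[xr xa] V Vx.
suff [v H] : exists v, \forall t \near (0 : R)^'+, interior D (x + t *: v).
  have /filter_ex[t [Dt Vt]] : \forall t \near (0 : R)^'+,
      interior D (x + t *: v) /\ V (x + t *: v).
    by apply: filterI => //; exact: near_ray.
  by exists (x + t *: v).
have lt1 : \forall t \near (0 : R)^'+, 0 < t /\ t < 1.
  by apply: filterI; [exact: nbhs_right_gt | exact: nbhs_right_lt].
move: xr; rewrite le_eqVlt => /orP[/eqP xr|xr].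
  have far : \forall y \near x, forall i, r ^+ 2 < sqn (y - a i).
    by apply: (@filter_forall _ _ (fun i y => r ^+ 2 < sqn (y - a i)) (nbhs x)) => i; apply/near_sqn_gt/outer_point_far; rewrite xr.
  exists (- x); near=> t; apply: interior_pot_domain.
    have /andP[t0 t1] : 0 < t < 1 by apply/andP; near: t.
    rewrite scalerN -scaleNr -[X in X + _]scale1r -scalerDl sqnZ xr.
    rewrite gtr_pMl ?exprn_gt0 // expr_lt1 //; lra.
  by near: t; apply: near_ray far.
have near_r v : \forall t \near (0 : R)^'+, sqn (x + t *: v) < rho ^+ 2.
  have := @near_sqn_lt R d 0 x (rho ^+ 2); rewrite subr0 => /(_ xr)/near_ray-/(_ v).
  by apply: filterS => y; rewrite subr0.
have [[i xi]|nx] := pselect (exists i, sqn (x - a i) = r ^+ 2); last first.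
  exists 0; near=> t; rewrite scaler0 addr0; apply: interior_pot_domain => // i.
  by rewrite lt_neqAle xa andbT; apply/eqP => E; apply: nx; exists i.
have far j : j != i -> \forall y \near x, r ^+ 2 < sqn (y - a j).
  by move=> ji; apply: near_sqn_gt; apply: (@other_balls_far i); rewrite 1?eq_sym ?xi.
have far' : \forall y \near x, forall j, j != i -> r ^+ 2 < sqn (y - a j).
  apply: (@filter_forall _ _ (fun j y => j != i -> r ^+ 2 < sqn (y - a j)) (nbhs x)) => j.
  have [->|ji] := eqVneq j i; first by apply: filterE.
  by apply: filterS (far _ ji).
exists (x - a i); near=> t; apply: interior_pot_domain; first by near: t.
move=> j; have [->|ji] := eqVneq j i.
  have /andP[t0 t1] : 0 < t < 1 by apply/andP; near: t.
  rewrite addrAC -[X in X + _]scale1r -scalerDl sqnZ xi.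
  by rewrite ltr_pMl ?exprn_gt0 // exprn_egt1 // ltrDl.
by move: j ji; near: t; exact: near_ray far'.
Unshelve. all: by end_near. Qed.

End Domain.

(** * Labels of the gradient field *)

Section Labels.
Variables (R : realType) (d n : nat) (a : 'I_n -> 'rV[R]_d) (r rho : R).
Hypotheses (d0 : (0 < d)%N) (r0 : 0 < r) (rho0 : 0 < rho).
Hypothesis balls_disjoint :
  forall i j, i != j -> Ball r (a i) `&` Ball r (a j) = set0.
Hypothesis balls_inside : \bigcup_i Ball (2 * r) (a i) `<=` Ball rho 0.

Local Notation D := (pot_domain a r rho).

Variables (g : 'rV[R]_d -> 'rV[R]_d) (b0 : bool) (b : 'I_n -> bool).
Hypothesis g_cont : {within D, continuous g}.
Hypothesis g_neq0 : forall x, D x -> g x != 0.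
Hypothesis g_outer :
  forall x, sqn x = rho ^+ 2 -> 0 < (-1) ^+ b0 * dot (g x) x.
Hypothesis g_inner : forall i x, sqn (x - a i) = r ^+ 2 ->
  0 < (-1) ^+ b i * dot (g x) (x - a i).

(* The sign pattern of the field that equals [g] on the domain, [± (x - a i)] in
   the removed balls and [± x] outside. This field may jump across the spheres,
   but there some coordinate keeps its sign. *)
Definition field_label (x : 'rV[R]_d) (k : 'I_d) : bool :=
  if rho ^+ 2 < sqn x then (0 < x 0 k) (+) b0
  else if [pick i | sqn (x - a i) < r ^+ 2] is Some i
       then (a i 0 k < x 0 k) (+) b i
       else 0 < g x 0 k.

Lemma field_label_outside x k : rho ^+ 2 < sqn x ->
  field_label x k = (0 < x 0 k) (+) b0.
Proof. by rewrite /field_label => ->. Qed.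

Lemma field_label_ball i x k : sqn (x - a i) < r ^+ 2 ->
  field_label x k = (a i 0 k < x 0 k) (+) b i.
Proof.
move=> xi; have xr := ball_inside r0 rho0 balls_inside (ltW xi).
rewrite /field_label ltNge (ltW xr) /=; case: pickP => [j xj|/(_ i)]; last first.
  by rewrite xi.
have [->//|ji] := eqVneq j i.
by have := other_balls_far r0 balls_disjoint ji (ltW xj); rewrite ltNge (ltW xi).
Qed.

Lemma field_label_domain x k : D x -> field_label x k = (0 < g x 0 k).
Proof.
move=> /(pot_domainE _ r0 rho0)[xr xa]; rewrite /field_label ltNge xr /=.
by case: pickP => // i; rewrite ltNge xa.
Qed.

Lemma near_field_coord x k : D x -> g x 0 k != 0 ->
  \forall y \near x, D y -> (0 < g y 0 k) = (0 < g x 0 k).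
Proof.
move=> Dx gk; have /subspace_continuousP/(_ x Dx) c := g_cont.
have := @near_coord_gt R d 0 (g x) k; rewrite mxE => /(_ gk)/c.
by rewrite /= /nbhs /= /within /=; apply: filterS => y H /H.
Qed.

(** Off the spheres the field is continuous and nonzero, so some nonzero coordinate keeps its sign.
    On a sphere the boundary condition provides a coordinate on which both sides agree. *)
Lemma field_label_locally_const x : (forall i, x != a i) ->
  exists k c, \forall y \near x, field_label y k = c.
Proof.
move=> xa.
have near_far : (forall i, r ^+ 2 < sqn (x - a i)) ->
    \forall y \near x, forall i, r ^+ 2 < sqn (y - a i).
  move=> H; apply: (@filter_forall _ _ (fun i y => r ^+ 2 < sqn (y - a i)) (nbhs x)) => i.
  exact: near_sqn_gt.
have [xr|xr|xr] := ltgtP (sqn x) (rho ^+ 2).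
- have yr : \forall y \near x, sqn y < rho ^+ 2.
    have := @near_sqn_lt R d 0 x (rho ^+ 2); rewrite subr0 => /(_ xr).
    by apply: filterS => y; rewrite subr0.
  have [[i xi]|nx] := pselect (exists i, sqn (x - a i) < r ^+ 2).
    have [k kx] := row_neq_coord (xa i).
    exists k, ((a i 0 k < x 0 k) (+) b i).
    apply: filterS (filterI (near_sqn_lt xi) (near_coord_gt kx)) => y [yi yk].
    by rewrite (field_label_ball _ yi) yk.
  have Dx : D x.
    apply/pot_domainE => //; split=> [|i]; first exact: ltW.
    by rewrite leNgt; apply/negP => xi; apply: nx; exists i.
  have [[i xi]|nx'] := pselect (exists i, sqn (x - a i) = r ^+ 2).
    (* On an inner sphere, [g] and the signed field [x - a i] share a strict sign in coordinate [k];
       nearby points on either side get the same label. *)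
    have [k [gk xk gxk]] := dot_gt0_coord (g_inner xi).
    have {}xk : x 0 k != a i 0 k by rewrite !mxE subr_eq0 in xk.
    rewrite !mxE subr_gt0 in gxk.
    exists k, (0 < g x 0 k).
    have far : \forall y \near x, forall j, j != i -> r ^+ 2 < sqn (y - a j).
      apply: (@filter_forall _ _ (fun j y => j != i -> r ^+ 2 < sqn (y - a j))
        (nbhs x)) => j.
      have [->|ji] := eqVneq j i; first by apply: filterE.
      have H : \forall y \near x, r ^+ 2 < sqn (y - a j).
        apply: near_sqn_gt; apply: (@other_balls_far _ _ _ _ _ r0 balls_disjoint i).
          by rewrite eq_sym.
        by rewrite xi.
      by apply: filterS H.
    apply: filterS (filterI (filterI yr far)
      (filterI (near_coord_gt xk) (near_field_coord Dx gk))).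
    move=> y [[{}yr {}far] [yk Dyk]].
    have [yi|yi] := ltP (sqn (y - a i)) (r ^+ 2).
      by rewrite (field_label_ball _ yi) yk gxk.
    have Dy : D y.
      apply/pot_domainE => //; split=> [|j]; first exact: ltW.
      by have [->//|ji] := eqVneq j i; exact/ltW/far.
    by rewrite field_label_domain // Dyk.
  (* Here [x] is off all spheres, and the absence of zeros of [g] supplies the coordinate. *)
  have [k gk] := row_neq_coord (g_neq0 Dx); rewrite mxE in gk.
  have far : forall i, r ^+ 2 < sqn (x - a i).
    move=> i; rewrite ltNge le_eqVlt; apply/negP => /orP[/eqP xi|xi].
      by apply: nx'; exists i.
    by apply: nx; exists i.
  exists k, (0 < g x 0 k).
  apply: filterS (filterI (filterI yr (near_far far)) (near_field_coord Dx gk)).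
  move=> y [[{}yr {}far'] Dyk].
  have Dy : D y.
    by apply/pot_domainE => //; split=> [|j]; exact: ltW.
  by rewrite field_label_domain // Dyk.
- have x0 : x != 0.
    apply: contraTneq xr => ->; rewrite /sqn /dot big1 ?ltNge ?sqr_ge0 // => k _.
    by rewrite mxE mul0r.
  have [k kx] := row_neq_coord x0; exists k, ((0 < x 0 k) (+) b0).
  have yr : \forall y \near x, rho ^+ 2 < sqn y.
    have := @near_sqn_gt R d 0 x (rho ^+ 2); rewrite subr0 => /(_ xr).
    by apply: filterS => y; rewrite subr0.
  apply: filterS (filterI yr (near_coord_gt kx)) => y [{}yr].
  by rewrite !mxE field_label_outside // => ->.
- have far i : r ^+ 2 < sqn (x - a i).
    by apply: (outer_point_far r0 rho0 balls_inside); rewrite xr.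
  have Dx : D x.
    by apply/pot_domainE => //; rewrite xr; split=> // i; exact: ltW.
  have [k [gk xk gxk]] := dot_gt0_coord (g_outer xr).
  have {}xk : x 0 k != (0 : 'rV[R]_d) 0 k by rewrite mxE.
  exists k, (0 < g x 0 k).
  apply: filterS (filterI (near_far far)
    (filterI (near_coord_gt xk) (near_field_coord Dx gk))).
  move=> y [{}far [yk Dyk]]; rewrite !mxE in yk.
  have [yr|yr] := ltP (rho ^+ 2) (sqn y).
    by rewrite field_label_outside // yk gxk.
  have Dy : D y by apply/pot_domainE => //; split=> // i; exact: ltW.
  by rewrite field_label_domain // Dyk.
Qed.

Lemma degree_identity :
  ((-1) ^+ b0) ^+ d = \sum_i ((-1) ^+ b i) ^+ d :> int.
Proof.
(* Any [L > rho] would put the boundary of the grid outside the large ball. *)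
pose L := 2 * rho; have L0 : 0 < L by rewrite mulr_gt0.
have coord_lt (x : 'rV[R]_d) k : sqn x < rho ^+ 2 -> - L <= x 0 k < L.
  move=> /(le_lt_trans (coord_sqn x k)).
  rewrite -(real_normK (num_real _)) ltr_pXn2r ?nnegrE ?(ltW rho0) // ltr_norml => /andP[].
  rewrite /L => h1 h2; apply/andP; split; lra.
have inG := @sum_local_degree_labels R d L L0 n field_label a b
  (fun i => [set x | sqn (x - a i) < r ^+ 2])
  (fun i k => coord_lt _ k (center_inside r0 rho0 balls_inside i)).
have sqn0 : sqn (0 : 'rV[R]_d) = 0.
  by rewrite /sqn /dot big1 // => k _; rewrite mxE mul0r.
have {}inG := inG (fun i => near_sqn_lt (_ : sqn (a i - a i) < r ^+ 2)).
have {}inG : \forall M \near \oo, \sum_(z : 'rV['I_M.+2]_d | off_seam z)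
    local_degree (grid_label L field_label (M := M)) z = \sum_i ((-1) ^+ b i) ^+ d.
  apply: inG => [i|i j x xi xj|i x xi k|]; last exact: field_label_locally_const.
  - by rewrite subrr sqn0 exprn_gt0.
  - apply/eqP; apply: contraT => ij.
    by have := other_balls_far r0 balls_disjoint ij (ltW xi); rewrite ltNge (ltW xj).
  - exact: field_label_ball.
(* The comparison field [± x] is counted with the origin as its only centre and the whole space as
   its neighbourhood. *)
pose G0 (x : 'rV[R]_d) (k : 'I_d) := (0 < x 0 k) (+) b0.
have inG0 : \forall M \near \oo, \sum_(z : 'rV['I_M.+2]_d | off_seam z)
    local_degree (grid_label L G0 (M := M)) z = \sum_(i < 1) ((-1) ^+ b0) ^+ d.
  apply: (@sum_local_degree_labels R d L L0 1 G0 (fun=> 0) (fun=> b0) (fun=> setT)).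
  - by move=> _ k; apply: coord_lt; rewrite sqn0 exprn_gt0.
  - by move=> _; exact: filterT.
  - by move=> i j _ _ _; rewrite [i]ord1 [j]ord1.
  - by move=> _ x _ k; rewrite /G0 mxE.
  - move=> x /(_ ord0)/row_neq_coord[k kx]; exists k, ((0 < x 0 k) (+) b0).
    by apply: filterS (near_coord_gt kx) => y; rewrite /G0 !mxE => ->.
have /filter_ex[M [sG sG0]] : \forall M \near \oo,
    \sum_(z : 'rV['I_M.+2]_d | off_seam z)
      local_degree (grid_label L field_label (M := M)) z = \sum_i ((-1) ^+ b i) ^+ d
    /\ \sum_(z : 'rV['I_M.+2]_d | off_seam z)
      local_degree (grid_label L G0 (M := M)) z = \sum_(i < 1) ((-1) ^+ b0) ^+ d.
  exact: filterI inG inG0.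
rewrite big_ord1 in sG0; rewrite -sG -sG0 -/G0; apply: eq_sum_local_degree => //.
(* A grid point next to the seam has a coordinate [± L], so its norm exceeds [rho] and both
   labellings agree there. *)
move=> z /existsP[k zk] l; rewrite /grid_label field_label_outside //.
apply: lt_le_trans (coord_sqn _ k); rewrite -[X in _ < X](real_normK (num_real _)).
rewrite ltr_pXn2r ?nnegrE ?(ltW rho0) ?normr_ge0 // mxE.
have -> : `|- L + mesh L M * (z 0 k)%:R| = L.
  case/orP: zk => /eqP ->; first by rewrite mulr0 addr0 normrN gtr0_norm.
  rewrite /mesh divfK ?pnatr_eq0 // (_ : - L + 2 * L = L) ?gtr0_norm //; ring.
by rewrite /L mulr_natl mulr2n ltrDl.
Qed.

End Labels.

(** * Parity of the dimension and the contradiction *)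

Lemma is_signE (s : int) : is_sign s -> s = (-1) ^+ (s == -1).
Proof. by case=> ->. Qed.

Theorem theoremB1 (R : realType) (d n : nat) (n_ge2 : (2 <= n)%N)
    (a : 'I_n -> 'rV[R]_d) (r rho : R) (f : 'rV[R]_d -> R)
    (fP : generalized_potential a r rho f)
    (s0 : int) (s : 'I_n -> int)
    (s0P : is_sign s0) (sP : forall i, is_sign (s i))
    (delta : R) (delta_gt0 : 0 < delta)
    (fbc : boundary_conditions a r rho f s0 s delta)
    (dP : ~~ odd d \/ (odd d /\ s0 - \sum_(i < n) s i != 0)) :
  exists x : 'rV[R]_d, equilibrium a r rho f x.
Proof.
case: fP => a_inj [r0 disj] [rho0 inside] [_ _ [g [g_cont gE]]].
(* The space of dimension 0 is a single point and cannot hold two distinct centres. *)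
have d0 : (0 < d)%N.
  rewrite lt0n; apply/eqP => dE.
  suff /a_inj : a (Ordinal (ltnW n_ge2)) = a (Ordinal n_ge2) by [].
  by apply/rowP => -[k kd]; exfalso; rewrite dE in kd.
apply: contrapT => noeq.
have nablaE x : pot_domain a r rho x -> grad_on (pot_domain a r rho) f x = g x.
  move=> Dx; apply: grad_onE => //.
  exact: closure_interior_pot_domain.
have g_neq0 x : pot_domain a r rho x -> g x != 0.
  move=> Dx; apply/eqP => gx0; apply: noeq; exists x; split => //.
  by rewrite nablaE.
case: fbc => bc0 bcs.
have := @degree_identity R d n a r rho d0 r0 rho0 disj inside g
  (s0 == -1) (fun i => s i == -1) g_cont g_neq0.
have sgnE (t : int) : is_sign t -> t%:~R = (-1) ^+ (t == -1) :> R.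
  by case=> ->.
rewrite -is_signE //; under [in X in _ -> _ -> X]eq_bigr do rewrite -is_signE //.
move=> main.
have {main} : s0 ^+ d = \sum_i s i ^+ d.
  apply: main => [x xr|i x xi].
    have Dx : pot_domain a r rho x.
      apply/pot_domainE => //; rewrite xr; split=> // i; apply: ltW.
      by apply: (outer_point_far r0 rho0 inside); rewrite xr.
    rewrite -nablaE // -sgnE //; apply: lt_le_trans (bc0 x _) => //.
    by apply: SphereE; rewrite ?(ltW rho0) // subr0.
  have Dx : pot_domain a r rho x.
    apply/pot_domainE => //; split=> [|j].
      by apply: ltW; apply: (ball_inside r0 rho0 inside (i := i)); rewrite xi.
    have [->|ij] := eqVneq j i; first by rewrite xi.
    apply: ltW; apply: (other_balls_far r0 disj (i := i)); first by rewrite eq_sym.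
    by rewrite xi.
  rewrite -nablaE // -sgnE //; apply: lt_le_trans (bcs i x _) => //.
  by apply: SphereE; rewrite ?(ltW r0).
have powE (t : int) : is_sign t -> t ^+ d = if odd d then t else 1.
  by case=> ->; rewrite ?expr1n ?if_same // -signr_odd; case: (odd d).
rewrite powE //; under eq_bigr do rewrite powE //.
(* For odd [d] the identity reads [s0 = \sum_i s i], which is excluded; for even [d] it reads
   [1 = n], contrary to [n >= 2]. *)
case: dP => [/negPf ->|[-> /eqP ds] /= E]; last by apply: ds; rewrite E subrr.
rewrite sumr_const card_ord => /eqP; rewrite eq_sym -[X in _ == X]/(1%:R).
by rewrite pnatr_eq1 => /eqP n1; rewrite n1 in n_ge2.
Qed.
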